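(* Let $m\ge 0$ be an integer, $\mathbb{Z}_m=\{k\in\mathbb{Z}:k\ge m\}$, and $c\in(0,\infty)$. Let $a,b$ be real sequences on $\mathbb{Z}_m$ and $F:\mathbb{R}\to\mathbb{R}$ a function such that: (i) $a_k>0$ for $k\in\mathbb{Z}_m$ and $\sum_{j=m}^{\infty}\frac1{a_j}<\infty$; (ii) $b_k\ge 0$ for $k\in\mathbb{Z}_m$ and $\sum_{j=m}^{\infty}b_j\sum_{i=j}^{\infty}\frac1{a_i}<\infty$; (iii) $F$ is continuous on $\mathbb{R}$, $F(u)u>0$ for $u\neq0$, and the limit $\lim_{u\to0+}\frac{F(u)}{u}$ exists and is finite. Put $L_c=\sup_{u\in(0,c]}\frac{F(u)}{u}$. If the linear difference equation $$\Delta\left(\frac{a_k}{\sqrt{1+c^2}}\,\Delta z_k\right)+L_cb_kz_{k+1}=0,\quad k\in\mathbb{Z}_m,$$ has a positive decreasing solution on $\mathbb{Z}_m$, then the boundary value problem $$\Delta\left(a_k\frac{\Delta x_k}{\sqrt{1+(\Delta x_k)^2}}\right)+b_kF(x_{k+1})=0,\quad k\in\mathbb{Z}_m,$$ $$x_m=c,\quad x_k>0,\quad \Delta x_k\le 0\ \ (k\in\mathbb{Z}_m),\quad \lim_{k\to\infty}x_k=0,$$ has at least one solution.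
   Context: $\Delta x_k=x_{k+1}-x_k$. A solution on $\mathbb{Z}_m$ is a real sequence on $\mathbb{Z}_m$ satisfying the equation for every $k\in\mathbb{Z}_m$. ''Positive decreasing'' means $z_k>0$ and $\Delta z_k<0$ for all $k\in\mathbb{Z}_m$. *)

(* Defs.v *)
From HB Require Import structures.
From mathcomp Require Import all_boot all_order all_algebra.
From mathcomp Require Import all_classical all_reals all_analysis.

Set Implicit Arguments.
Unset Strict Implicit.
Unset Printing Implicit Defensive.

Import Order.TTheory GRing.Theory Num.Theory.
Import numFieldNormedType.Exports.

Local Open Scope ring_scope.

(* A sequence on {k | m <= k} is a total function nat -> R of which only the
   values at indices k >= m are ever constrained or used. *)

(* Delta u k = u k.+1 - u k *)
Notation Delta := telescope.

Definition linear_solution (R : realType) (m : nat) (c L : R)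
    (a b z : nat -> R) : Prop :=
  forall k, (m <= k)%N ->
    Delta (fun j => a j / Num.sqrt (1 + c ^+ 2) * Delta z j) k
      + L * b k * z k.+1 = 0.

Definition curvature_solution (R : realType) (m : nat) (a b : nat -> R)
    (F : R -> R) (x : nat -> R) : Prop :=
  forall k, (m <= k)%N ->
    Delta (fun j => a j * (Delta x j / Num.sqrt (1 + Delta x j ^+ 2))) k
      + b k * F (x k.+1) = 0.

Definition positive_decreasing (R : realType) (m : nat) (z : nat -> R) : Prop :=
  forall k, (m <= k)%N -> 0 < z k /\ Delta z k < 0.

(* Main.v *)
Require Import Defs.
From HB Require Import structures.
From mathcomp Require Import all_boot all_order all_algebra ring lra.
From mathcomp Require Import all_classical all_reals all_analysis.

Set Implicit Arguments.
Unset Strict Implicit.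
Unset Printing Implicit Defensive.

Import Order.TTheory GRing.Theory Num.Theory.
Import numFieldNormedType.Exports.

Local Open Scope classical_set_scope.
Local Open Scope ring_scope.

(** The problem is solved by shooting on the initial flux.  Put
    p_k = - a_k * slope (Delta x_k) with slope v = v / sqrt (1 + v^2).  The
    equation becomes the first-order recursion
      x_(k+1) = x_k - slope^-1 (p_k / a_k),
      p_(k+1) = p_k + b_k F(x_(k+1)),
    started at x_m = c with a free parameter p_m = t >= 0.  To make every shot
    total, the inverse of slope is replaced by [unslope], which agrees with it
    on the increments of size at most c, the only ones a solution can have,
    and F is evaluated at the projection of x onto [0, c].

    Along a shot, p is nonnegative and nondecreasing and x is nonincreasing.
    Put T = c * a_m and let B bound F on [0, c].  Then p_k is at most
    P_k = T + B * sum_(j < k) b_j, uniformly in t in [0, T], so each drop of x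
    is at most a constant times P_k / a_k.  These bounds are summable: this
    follows from the summability of 1 / a and, after exchanging the order of
    summation, from the double-sum hypothesis ([drop_bound_summable]).  Therefore the shots converge uniformly
    in t and their limit x_oo(t) is a continuous function of t
    ([drops_limit_continuous]).

    For t = T the first step already reaches 0 or below, so x_oo(T) <= 0.  For t = 0 the linear equation enters: a Riccati-type
    comparison of p / x with the corresponding quotient of the positive
    decreasing solution z shows that the shot stays positive
    ([height_gt0_of_linear]), so x_oo(0) >= 0.  The intermediate value theorem
    gives t with x_oo(t) = 0 ([exists_decaying_shot]).  A shot with limit 0
    cannot touch 0 in finite time, because it would be constant from then on,
    which forces its flux, hence its whole past, to vanish
    ([height_gt0_of_lim0]).  Being positive, it never meets either of the two
    truncations and solves the original equation ([height_solves]). *)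

(** * The curvature nonlinearity and a total inverse *)

Definition slope (R : realType) (v : R) : R := v / Num.sqrt (1 + v ^+ 2).

Definition steepness (R : realType) (c : R) : R := Num.sqrt (1 + c ^+ 2).

(** The inverse of [slope] is w / sqrt (1 - w^2), defined for |w| < 1 only.
    Freezing the denominator once |w| reaches [slope c] extends it beyond
    [slope c] by the line of slope [steepness c] through the origin, which
    meets the graph at ([slope c], c). *)
Definition unslope (R : realType) (c w : R) : R :=
  w / Num.sqrt (1 - Num.min `|w| (slope c) ^+ 2).

Section unslope_theory.
Variables (R : realType) (c : R).
Hypothesis c_gt0 : 0 < c.

Lemma steepness_ge1 : 1 <= steepness c.
Proof.
by rewrite -[leLHS]sqrtr1 /steepness ler_sqrt ?lerDl ?sqr_ge0 // addr_ge0 ?sqr_ge0.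
Qed.

Lemma steepness_gt0 : 0 < steepness c.
Proof. exact: lt_le_trans steepness_ge1. Qed.

Lemma sqr_slope (v : R) : 1 - slope v ^+ 2 = (1 + v ^+ 2)^-1.
Proof.
have v2 : 0 < 1 + v ^+ 2 by rewrite ltr_pwDl // sqr_ge0.
rewrite /slope expr_div_n sqr_sqrtr ?ltW//.
by apply/(mulIf (lt0r_neq0 v2)); rewrite mulrBl divfK ?mulVf ?lt0r_neq0//; ring.
Qed.

Lemma slope_ge0 : 0 <= slope c.
Proof. by rewrite divr_ge0 ?ltW ?steepness_gt0. Qed.

Lemma unslope_denom_bounds (w : R) :
  (steepness c)^-1 <= Num.sqrt (1 - Num.min `|w| (slope c) ^+ 2) <= 1.
Proof.
have min_ge0 : 0 <= Num.min `|w| (slope c) by rewrite le_min normr_ge0 slope_ge0.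
have min_le : Num.min `|w| (slope c) ^+ 2 <= slope c ^+ 2.
  by rewrite ler_sqr ?nnegrE ?slope_ge0// ge_min lexx orbT.
have lo : (1 + c ^+ 2)^-1 <= 1 - Num.min `|w| (slope c) ^+ 2.
  by rewrite -sqr_slope lerD2l lerN2.
have inv_ge0 : 0 <= (1 + c ^+ 2)^-1 by rewrite invr_ge0 addr_ge0 ?sqr_ge0.
apply/andP; split.
  by rewrite /steepness -sqrtrV ?addr_ge0 ?sqr_ge0// ler_sqrt// (le_trans _ lo).
rewrite -[leRHS]sqrtr1 ler_sqrt// gerBl; exact: sqr_ge0.
Qed.

Lemma unslope_denom_gt0 (w : R) :
  0 < Num.sqrt (1 - Num.min `|w| (slope c) ^+ 2).
Proof.
have /andP[+ _] := unslope_denom_bounds w; apply: lt_le_trans.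
by rewrite invr_gt0 steepness_gt0.
Qed.

Lemma unslope_continuous : continuous (unslope c).
Proof.
move=> w; apply: cvgM; first exact: cvg_id.
apply: cvgV; first by rewrite gt_eqF ?unslope_denom_gt0.
apply: (@continuous_comp _ _ _
  (fun w => 1 - Num.min `|w| (slope c) ^+ 2) Num.sqrt); last exact: sqrt_continuous.
apply: cvgB; first exact: cvg_cst.
apply: (@continuous_comp _ _ _
  (fun w => Num.min `|w| (slope c)) (fun u => u ^+ 2)); last exact: exprn_continuous.
apply: (@continuous_min _ _ (fun w => `|w|) (fun=> slope c)).
  exact: norm_continuous.
exact: cvg_cst.
Qed.

Lemma unslope_ge (w : R) : 0 <= w -> w <= unslope c w.
Proof.
move=> w_ge0; have /andP[_ hi] := unslope_denom_bounds w.
by rewrite /unslope ler_pdivlMr ?unslope_denom_gt0// ler_piMr.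
Qed.

Lemma unslope_le (w : R) : 0 <= w -> unslope c w <= steepness c * w.
Proof.
move=> w_ge0; have /andP[lo _] := unslope_denom_bounds w.
rewrite /unslope mulrC ler_wpM2r// -[leRHS]invrK lef_pV2//.
  by rewrite posrE unslope_denom_gt0.
by rewrite posrE invr_gt0 steepness_gt0.
Qed.

(** Beyond [slope c], [unslope] is linear with value c at [slope c]; so an
    output of at most c comes from the part where nothing is truncated. *)
Lemma unslopeK (w : R) : 0 <= w -> unslope c w <= c -> slope (unslope c w) = w.
Proof.
move=> w_ge0 small.
have w_le : w <= slope c.
  rewrite leNgt; apply/negP => w_gt.
  have minE : Num.min `|w| (slope c) = slope c.
    by apply/min_idPr; rewrite ger0_norm// ltW.
  move: small; rewrite /unslope minE sqr_slope sqrtrV ?addr_ge0 ?sqr_ge0// invrK.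
  by rewrite leNgt -ltr_pdivrMr ?steepness_gt0// w_gt.
have minE : Num.min `|w| (slope c) = w.
  by rewrite ger0_norm//; apply/min_idPl.
have := unslope_denom_gt0 w; rewrite /unslope minE => den_gt0.
have w2 : 0 < 1 - w ^+ 2 by rewrite -sqrtr_gt0.
have inv_eq : 1 + (w / Num.sqrt (1 - w ^+ 2)) ^+ 2 = (1 - w ^+ 2)^-1.
  rewrite expr_div_n sqr_sqrtr ?ltW//.
  by apply/(mulIf (lt0r_neq0 w2)); rewrite mulrDl divfK ?mulVf ?lt0r_neq0//; ring.
by rewrite /slope inv_eq sqrtrV ?ltW// invrK divfK ?lt0r_neq0.
Qed.

End unslope_theory.

(** * Continuity of a limit under summable drops *)

Section limit_of_summable_drops.
Variables (R : realType) (X : R -> nat -> R) (D : nat -> R).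
Hypothesis drop : forall t n, 0 <= X t n - X t n.+1 <= D n.
Hypothesis D_sum : cvgn (series D).

Lemma drops_nonincreasing t : nonincreasing_seq (X t).
Proof.
by apply/nonincreasing_seqP => n; rewrite -subr_ge0; case/andP: (drop t n).
Qed.

Lemma drops_le t n k : (n <= k)%N -> X t n - X t k <= series D k - series D n.
Proof.
move=> /subnK <-; elim: (k - n)%N => [|j IH]; first by rewrite !subrr.
have /andP[_] := drop t (j + n).
by rewrite addSn [series D (j + n).+1]seriesSr; move: IH; lra.
Qed.

Lemma drops_ge0 n : 0 <= D n.
Proof. by have /andP[] := drop 0 n; exact: le_trans. Qed.

Lemma drops_series_le n : series D n <= limn (series D).
Proof.
apply: nondecreasing_cvgn_le => //.
by apply/nondecreasing_seqP => k; rewrite seriesSr lerDl drops_ge0.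
Qed.

Lemma drops_is_cvg t : cvgn (X t).
Proof.
apply: nonincreasing_is_cvgn; first exact: drops_nonincreasing.
exists (X t 0 - limn (series D)) => _ [n _ <-].
have := drops_le t (leq0n n).
rewrite {2}/series/= big_geq// subr0.
by have := drops_series_le n; lra.
Qed.

(** The bound is uniform in t, which is what transfers continuity to the
    limit. *)
Lemma drops_tail t n :
  0 <= X t n - limn (X t) <= limn (series D) - series D n.
Proof.
apply/andP; split.
  rewrite subr_ge0; apply: nonincreasing_cvgn_ge (drops_nonincreasing t) _ n.
  exact: drops_is_cvg.
rewrite lerBlDr -lerBlDl; apply: limr_ge; first exact: drops_is_cvg.
near=> k; have nk : (n <= k)%N by near: k; exact: nbhs_infty_ge.
by have := drops_le t nk; have := drops_series_le k; lra.
Unshelve. all: by end_near. Qed.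

Lemma drops_limit_continuous :
  (forall n, continuous (X^~ n)) -> continuous (fun t => limn (X t)).
Proof.
move=> X_cont t; apply/cvgrPdist_lt => e e_gt0.
have e3 : 0 < e / 3 by rewrite divr_gt0.
have /cvgrPdist_lt/(_ _ e3)[n _ /(_ n (leqnn n))/= tail] := D_sum.
have /cvgrPdist_lt/(_ _ e3) := X_cont n t.
apply: filterS => s; rewrite !ltr_norml => /andP[lo hi].
move: tail; rewrite ltr_norml => /andP[_ tail].
have /andP[] := drops_tail t n; have /andP[] := drops_tail s n.
by move=> *; apply/andP; split; lra.
Qed.

End limit_of_summable_drops.

(** * Shooting *)

Lemma DeltaE (R : realType) (u : nat -> R) k : Delta u k = u k.+1 - u k.
Proof. by []. Qed.

Section shooting.
Variables (R : realType) (c B : R) (a b : nat -> R) (F : R -> R).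
Hypothesis c_gt0 : 0 < c.
Hypothesis a_gt0 : forall n, 0 < a n.
Hypothesis b_ge0 : forall n, 0 <= b n.
Hypothesis F_cont : continuous F.
Hypothesis F_bounds : forall u : R, 0 <= u <= c -> 0 <= F u <= B.

Definition clamp (hi u : R) : R := Num.max 0 (Num.min u hi).

Lemma clamp_continuous hi : continuous (clamp hi).
Proof.
move=> u; apply: (@continuous_max _ _ (fun=> 0) (fun v => Num.min v hi)).
  exact: cvg_cst.
by apply: (@continuous_min _ _ id (fun=> hi)); [exact: cvg_id|exact: cvg_cst].
Qed.

Lemma clamp_bounds hi u : 0 <= hi -> 0 <= clamp hi u <= hi.
Proof. by move=> hi_ge0; rewrite le_max lexx ge_max hi_ge0 ge_min lexx orbT. Qed.

Lemma clamp_id hi u : 0 <= u <= hi -> clamp hi u = u.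
Proof. by case/andP=> u_ge0 u_le; rewrite /clamp (min_idPl u_le); apply/max_idPr. Qed.

(** The state after n steps: the value x_n and the flux p_n.  The initial flux
    is clamped to [0, c * a 0] so that the estimates are uniform over all real
    parameters t. *)
Fixpoint shot (t : R) (n : nat) : R * R :=
  if n is k.+1 then
    let x := (shot t k).1 - unslope c ((shot t k).2 / a k) in
    (x, (shot t k).2 + b k * F (clamp c x))
  else (c, clamp (c * a 0) t).

Definition height t n := (shot t n).1.
Definition flux t n := (shot t n).2.

Lemma heightS t n : height t n.+1 = height t n - unslope c (flux t n / a n).
Proof. by []. Qed.

Lemma fluxS t n : flux t n.+1 = flux t n + b n * F (clamp c (height t n.+1)).
Proof. by []. Qed.

Lemma shot_continuous n : continuous (height^~ n) /\ continuous (flux^~ n).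
Proof.
elim: n => [|n [height_n flux_n]].
  by split=> t; [exact: cvg_cst | exact: clamp_continuous].
have height_n1 : continuous (height^~ n.+1).
  move=> t; apply: cvgB; first exact: height_n.
  apply: (@continuous_comp _ _ _ (fun t => flux t n / a n) (unslope c)).
    by apply: cvgM; [exact: flux_n | exact: cvg_cst].
  exact: unslope_continuous.
split=> // t; apply: cvgD; first exact: flux_n.
apply: cvgM; first exact: cvg_cst.
apply: (@continuous_comp _ _ _ (fun t => clamp c (height t n.+1)) F); last exact: F_cont.
apply: (@continuous_comp _ _ _ (height^~ n.+1) (clamp c)); first exact: height_n1.
exact: clamp_continuous.
Qed.

Lemma flux0_bounds t : 0 <= flux t 0 <= c * a 0.
Proof. by apply: clamp_bounds; rewrite mulr_ge0 ?ltW. Qed.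

Lemma flux_step t n : flux t n <= flux t n.+1 <= flux t n + B * b n.
Proof.
have /F_bounds/andP[F_ge0 F_le] := clamp_bounds (height t n.+1) (ltW c_gt0).
by rewrite fluxS lerDl mulr_ge0// lerD2l [B * _]mulrC ler_wpM2l.
Qed.

Lemma flux_nondecreasing t : nondecreasing_seq (flux t).
Proof. by apply/nondecreasing_seqP => n; have /andP[] := flux_step t n. Qed.

Lemma flux_ge0 t n : 0 <= flux t n.
Proof.
by have /andP[+ _] := flux0_bounds t; move/le_trans; apply; exact: flux_nondecreasing.
Qed.

Lemma flux_le t n : flux t n <= c * a 0 + B * series b n.
Proof.
elim: n => [|n IH].
  by rewrite /series/= big_geq// mulr0 addr0; have /andP[] := flux0_bounds t.
have /andP[_] := flux_step t n.
by rewrite seriesSr mulrDr; move: IH; lra.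
Qed.

Definition drop_bound n := steepness c * ((c * a 0 + B * series b n) / a n).

Lemma height_drop t n : 0 <= height t n - height t n.+1 <= drop_bound n.
Proof.
rewrite heightS opprB addrCA subrr addr0.
have w_ge0 : 0 <= flux t n / a n by rewrite divr_ge0 ?flux_ge0 ?ltW.
rewrite (le_trans w_ge0) ?unslope_ge//=.
apply: le_trans (unslope_le c_gt0 w_ge0) _.
rewrite ler_wpM2l ?(ltW (steepness_gt0 _))// ler_wpM2r ?flux_le//.
by rewrite invr_ge0 ltW.
Qed.

Lemma height_le t n : height t n <= c.
Proof. exact: (drops_nonincreasing height_drop t (leq0n n)). Qed.

(** [unslope] does not decrease nonnegative arguments, so a flux of c * a 0
    produces a first drop of at least c. *)
Lemma height_overshoot : height (c * a 0) 1 <= 0.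
Proof.
have flux0 : flux (c * a 0) 0 = c * a 0.
  by apply: clamp_id; rewrite lexx mulr_ge0// ltW.
rewrite heightS flux0 mulfK ?lt0r_neq0// subr_le0.
by apply: unslope_ge; rewrite ?ltW.
Qed.

(** Comparison with the linear equation.  Let q be the flux of z in the linear
    equation.  Cross-multiplied, the claim p / x <= q / z is propagated by
    induction: it makes the relative drop of x no larger than that of z, so
    that x stays positive, and F u <= L * u then bounds the new flux. *)
Lemma height_gt0_of_linear (L : R) (z : nat -> R) :
  (forall u : R, 0 < u <= c -> F u <= L * u) ->
  linear_solution 0 c L a b z -> positive_decreasing 0 z ->
  forall n, 0 < height 0 n.
Proof.
move=> F_le z_sol z_pos.
have C_gt0 := steepness_gt0 c.
have z_gt0 n : 0 < z n by case: (z_pos n (leq0n n)).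
pose q n := - (a n / steepness c * Delta z n).
have q_ge0 n : 0 <= q n.
  case: (z_pos n (leq0n n)) => _ dz; rewrite /q -mulrN mulr_ge0//.
    by rewrite divr_ge0 ?ltW.
  by rewrite oppr_ge0 ltW.
have qS n : q n.+1 = q n + L * b n * z n.+1.
  have := z_sol n (leq0n n); rewrite /q /steepness !/telescope/= => eq_n.
  by apply: subr0_eq; rewrite -[RHS]oppr0 -eq_n; ring.
have zS n : z n.+1 = z n - steepness c * q n / a n.
  rewrite /q /telescope/=; field.
  by rewrite ?lt0r_neq0.
suff H n : 0 < height 0 n /\ flux 0 n * z n <= q n * height 0 n.
  by move=> n; case: (H n).
elim: n => [|n [x_gt0 cmp]].
  split=> //; have -> : flux 0 0 = 0.
    by apply: clamp_id; rewrite lexx mulr_ge0 ?ltW.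
  by rewrite mul0r mulr_ge0// ltW.
have ratio : height 0 n * z n.+1 <= z n * height 0 n.+1.
  have w_ge0 : 0 <= flux 0 n / a n by rewrite divr_ge0 ?flux_ge0 ?ltW.
  apply: (@le_trans _ _ (z n * (height 0 n - steepness c * (flux 0 n / a n)))).
    rewrite zS -subr_ge0.
    have -> : z n * (height 0 n - steepness c * (flux 0 n / a n)) -
        height 0 n * (z n - steepness c * q n / a n) =
        steepness c / a n * (q n * height 0 n - flux 0 n * z n) by ring.
    by rewrite mulr_ge0 ?subr_ge0// divr_ge0 ?ltW.
  by rewrite ler_wpM2l ?(ltW (z_gt0 n))// heightS lerD2l lerN2 unslope_le.
have x1_gt0 : 0 < height 0 n.+1.
  by rewrite -(pmulr_rgt0 _ (z_gt0 n)); apply: lt_le_trans ratio; rewrite mulr_gt0.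
split=> //.
have cmp' : flux 0 n * z n.+1 <= q n * height 0 n.+1.
  rewrite -(ler_pM2l (z_gt0 n)).
  apply: (@le_trans _ _ (q n * height 0 n * z n.+1)).
    by rewrite mulrA [z n * _]mulrC ler_wpM2r ?(ltW (z_gt0 _)).
  by rewrite mulrCA -mulrA ler_wpM2l.
rewrite fluxS clamp_id ?height_le ?(ltW x1_gt0)// qS !mulrDl lerD//.
rewrite -!mulrA [L * _]mulrCA ler_wpM2l// [z n.+1 * _]mulrC mulrA ler_wpM2r ?(ltW (z_gt0 _))//.
by apply: F_le; rewrite x1_gt0 height_le.
Qed.

Hypothesis drop_sum : cvgn (series drop_bound).

(** A zero at time n would be followed by zeros, as x is nonincreasing with
    limit 0; then p_n = 0, hence p vanishes up to n by monotonicity and x_n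
    is still equal to c. *)
Lemma height_gt0_of_lim0 t : limn (height t) = 0 -> forall n, 0 < height t n.
Proof.
move=> lim0.
have height_ge0 n : 0 <= height t n.
  rewrite -lim0; apply: nonincreasing_cvgn_ge.
    exact: drops_nonincreasing height_drop t.
  exact: drops_is_cvg height_drop drop_sum t.
move=> n; rewrite lt_neqAle height_ge0 andbT eq_sym; apply/eqP => xn0.
have xn1 : height t n.+1 = 0.
  apply/eqP; rewrite eq_le height_ge0 -xn0 andbT.
  exact: (drops_nonincreasing height_drop).
have w_ge0 : 0 <= flux t n / a n by rewrite divr_ge0 ?flux_ge0 ?ltW.
have fluxn0 : flux t n <= 0.
  have := unslope_ge c_gt0 w_ge0; move: xn1; rewrite heightS xn0 sub0r.
  by move/eqP; rewrite oppr_eq0 => /eqP ->; rewrite pmulr_lle0 ?invr_gt0.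
have flux0 k : (k <= n)%N -> flux t k = 0.
  move=> kn; apply/eqP; rewrite eq_le flux_ge0 andbT.
  by apply: le_trans fluxn0; exact: flux_nondecreasing.
have height_c k : (k <= n)%N -> height t k = c.
  elim: k => [//|k IH kn]; rewrite heightS IH ?flux0 ?(ltnW kn)//.
  by rewrite /unslope !mul0r subr0.
by move: c_gt0; rewrite -(height_c n (leqnn n)) xn0 ltxx.
Qed.

Lemma height_solves t : (forall n, 0 < height t n) ->
  curvature_solution 0 a b F (height t).
Proof.
move=> x_gt0.
have law n : a n * (Delta (height t) n / Num.sqrt (1 + Delta (height t) n ^+ 2))
    = - flux t n.
  have w_ge0 : 0 <= flux t n / a n by rewrite divr_ge0 ?flux_ge0 ?ltW.
  have -> : Delta (height t) n = - unslope c (flux t n / a n).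
    by rewrite DeltaE heightS addrAC subrr add0r.
  rewrite sqrrN mulNr mulrN -/(slope _) unslopeK//.
    by rewrite mulrC divfK ?lt0r_neq0.
  by have := x_gt0 n.+1; rewrite heightS; have := height_le t n; lra.
move=> n _; rewrite DeltaE !law fluxS clamp_id ?height_le ?(ltW (x_gt0 _))//.
by ring.
Qed.

(** Intermediate value theorem for the limit of the shot, which is nonnegative
    for zero initial flux and nonpositive for initial flux c * a 0. *)
Lemma exists_decaying_shot : (forall n, 0 < height 0 n) ->
  exists t, height t @ \oo --> (0 : R).
Proof.
move=> x_gt0; have is_cvg := drops_is_cvg height_drop drop_sum.
have T_ge0 : 0 <= c * a 0 by rewrite mulr_ge0 ?ltW.
have lim_lo : 0 <= limn (height 0).
  by apply: limr_ge; [exact: is_cvg | near=> n; exact: ltW].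
have lim_hi : limn (height (c * a 0)) <= 0.
  apply: le_trans height_overshoot; apply: nonincreasing_cvgn_ge => //.
  exact: drops_nonincreasing height_drop _.
have lim_cont : {within `[0, c * a 0], continuous (fun t => limn (height t))}.
  apply: continuous_subspaceT; apply: (drops_limit_continuous height_drop drop_sum).
  by move=> n; case: (shot_continuous n).
have [|t _ lim0] := IVT T_ge0 lim_cont (v := 0).
  by rewrite ge_min lim_hi orbT le_max lim_lo.
by exists t; rewrite -lim0; exact: is_cvg.
Unshelve. all: by end_near. Qed.

End shooting.

(** * Summability of the drop bounds *)

Section summability.
Variables (R : realType).
Implicit Types a b : nat -> R.

(** Exchange of summation over the pairs j <= i < n; the diagonal terms are
    missing on the left, since [series b i] stops at i - 1. *)
Lemma sum_series_div_le a b n : (forall k, 0 < a k) -> (forall k, 0 <= b k) ->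
  \sum_(0 <= i < n) series b i / a i
    <= \sum_(0 <= j < n) b j * \sum_(j <= i < n) (a i)^-1.
Proof.
move=> a_gt0 b_ge0; elim: n => [|n IH]; first by rewrite !big_geq.
have -> : \sum_(0 <= j < n.+1) b j * \sum_(j <= i < n.+1) (a i)^-1 =
    \sum_(0 <= j < n) b j * \sum_(j <= i < n) (a i)^-1 + series b n.+1 / a n.
  have -> : \sum_(0 <= j < n) b j * \sum_(j <= i < n) (a i)^-1 =
      \sum_(0 <= j < n.+1) b j * \sum_(j <= i < n) (a i)^-1.
    by rewrite [RHS]big_nat_recr//= [X in _ = _ + _ * X]big_geq// mulr0 addr0.
  rewrite /series/= mulr_suml -big_split/=; apply: eq_big_nat => j /andP[_ jn].
  by rewrite big_nat_recr//= mulrDr.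
rewrite big_nat_recr//= lerD// ler_wpM2r ?invr_ge0 ?(ltW (a_gt0 _))//.
by rewrite seriesSr lerDl.
Qed.

Lemma drop_bound_summable (c B S1 S2 : R) a b :
  0 < c -> 0 <= B -> (forall k, 0 < a k) -> (forall k, 0 <= b k) ->
  (forall n, \sum_(0 <= i < n) (a i)^-1 <= S1) ->
  (forall n, \sum_(0 <= j < n) b j * \sum_(j <= i < n) (a i)^-1 <= S2) ->
  cvgn (series (drop_bound c B a b)).
Proof.
move=> c_gt0 B_ge0 a_gt0 b_ge0 le_S1 le_S2.
have C_gt0 := steepness_gt0 c.
have b_series_ge0 n : 0 <= series b n by rewrite /series/= sumr_ge0.
apply: nondecreasing_is_cvgn.
  apply/nondecreasing_seqP => n; rewrite seriesSr lerDl /drop_bound.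
  rewrite mulr_ge0 ?(ltW C_gt0)// divr_ge0 ?(ltW (a_gt0 _))//.
  by rewrite addr_ge0 ?mulr_ge0 ?(ltW c_gt0) ?(ltW (a_gt0 _)).
exists (steepness c * (c * a 0 * S1 + B * S2)) => _ [n _ <-].
rewrite /series/= -mulr_sumr ler_wpM2l ?(ltW C_gt0)//.
under eq_bigr do rewrite mulrDl -[B * _ / _]mulrA.
rewrite big_split/= -!mulr_sumr lerD//.
  by rewrite ler_wpM2l// mulr_ge0 ?ltW.
by rewrite ler_wpM2l// (le_trans _ (le_S2 n))// sum_series_div_le.
Qed.

End summability.

(** * Bounds on the nonlinearity *)

Section nonlinearity.
Variables (R : realType) (F : R -> R) (c : R).
Hypothesis c_gt0 : 0 < c.
Hypothesis F_cont : continuous F.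
Hypothesis F_sign : forall u : R, u != 0 -> 0 < F u * u.

Lemma sign_gt0 u : 0 < u -> 0 < F u.
Proof. by move=> u_gt0; rewrite -(pmulr_lgt0 _ u_gt0) F_sign// gt_eqF. Qed.

(** At 0 the sign condition says nothing; the value there is the right limit
    of positive values. *)
Lemma sign_ge0 u : 0 <= u -> 0 <= F u.
Proof.
rewrite le_eqVlt => /predU1P[<-|/sign_gt0/ltW//].
have F0 : F u @[u --> 0^'+] --> F 0 by apply: cvg_at_right_filter; exact: F_cont.
apply: cvgr_to_ge F0 _; near=> v; apply/ltW/sign_gt0.
by near: v; exact: nbhs_right_gt.
Unshelve. all: by end_near. Qed.

Lemma sign_bounded : exists B, forall u : R, 0 <= u <= c -> 0 <= F u <= B.
Proof.
have [v _ F_le] := EVT_max (ltW c_gt0) (continuous_subspaceT F_cont).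
exists (F v) => u u_in; have /andP[u_ge0 _] := u_in.
by rewrite sign_ge0// F_le// in_itv.
Qed.

(** The point is that the supremum is a genuine upper bound: the ratio F u / u
    is bounded near 0 by the existence of the limit, and by B / d away from a
    neighbourhood of radius d, where B bounds F on [0, c]. *)
Lemma sign_le_sup_ratio : (exists l : R, F u / u @[u --> 0^'+] --> l) ->
  forall u : R, 0 < u <= c ->
    F u <= sup [set F u / u | u in [set u | 0 < u <= c]] * u.
Proof.
move=> [l F_lim]; have [B F_B] := sign_bounded.
have B_ge0 : 0 <= B.
  have /F_B/andP[] : 0 <= c <= c by rewrite ltW/=.
  exact: le_trans.
have l_lt : l < l + 1 by rewrite ltrDl.
have [d /= d_gt0 near0] := cvgr_le _ F_lim _ l_lt.
have sup_ratio : has_sup [set F u / u | u in [set u | 0 < u <= c]].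
  split; first by exists (F c / c), c => //=; rewrite c_gt0/=.
  exists (Num.max (l + 1) (B / d)) => _ [u /andP[u_gt0 u_le] <-].
  rewrite le_max; have [u_lt|d_le] := ltP u d.
    by rewrite near0//= sub0r normrN gtr0_norm.
  apply/orP; right.
  have /andP[_ Fu_le] : 0 <= F u <= B by rewrite F_B// ltW.
  by rewrite ler_pM ?invr_ge0 ?sign_ge0 ?(ltW u_gt0)// lef_pV2.
move=> u u_in; have /andP[u_gt0 _] := u_in.
by rewrite -ler_pdivrMr//; apply: sup_upper_bound => //; exists u.
Qed.

End nonlinearity.

(** * Real bounds from extended-real series *)

Lemma nneseries_partial_sums_le (R : realType) (u : nat -> \bar R) m :
  (forall j, (m <= j)%N -> 0 <= u j)%E -> (\sum_(m <= j <oo) u j < +oo)%E ->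
  exists S : R, forall n, (\sum_(m <= j < n) u j <= S%:E)%E.
Proof.
move=> u_ge0 u_fin; exists (fine (\sum_(m <= j <oo) u j)) => n.
rewrite fineK; first by apply: nneseries_lim_ge => j mj _; exact: u_ge0.
rewrite ge0_fin_numE//; apply: nneseries_ge0 => j mj _; exact: u_ge0.
Qed.

Lemma tail_sums_le (R : realType) m (a b : nat -> R) :
  (forall k, (m <= k)%N -> 0 < a k) -> (forall k, (m <= k)%N -> 0 <= b k) ->
  (\sum_(m <= j <oo) ((b j)%:E * \sum_(j <= i <oo) ((a i)^-1)%:E) < +oo)%E ->
  exists S : R, forall n,
    \sum_(m <= j < n) b j * \sum_(j <= i < n) (a i)^-1 <= S.
Proof.
move=> a_gt0 b_ge0 b_sum.
have inv_ge0 i : (m <= i)%N -> (0 <= ((a i)^-1)%:E)%E.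
  by move=> mi; rewrite lee_fin invr_ge0 ltW// a_gt0.
have tail_ge0 j : (m <= j)%N -> (0 <= \sum_(j <= i <oo) ((a i)^-1)%:E)%E.
  by move=> mj; apply: nneseries_ge0 => i ji _; rewrite inv_ge0// (leq_trans mj).
have [|S le_S] := nneseries_partial_sums_le _ b_sum.
  by move=> j mj; rewrite mule_ge0 ?lee_fin ?b_ge0 ?tail_ge0.
exists S => n; rewrite -lee_fin; apply: le_trans (le_S n).
rewrite -sumEFin !big_seq; apply: lee_sum => j.
rewrite mem_index_iota => /andP[mj _].
rewrite EFinM -sumEFin lee_wpmul2l ?lee_fin ?b_ge0//.
by apply: nneseries_lim_ge => i ji _; rewrite inv_ge0// (leq_trans mj).
Qed.

(** * The boundary value problem *)

Lemma bvp_solution_from_zero (R : realType) (c B L S1 S2 : R) (a b z : nat -> R) (F : R -> R) :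
  0 < c -> (forall k, 0 < a k) -> (forall k, 0 <= b k) ->
  (forall n, \sum_(0 <= i < n) (a i)^-1 <= S1) ->
  (forall n, \sum_(0 <= j < n) b j * \sum_(j <= i < n) (a i)^-1 <= S2) ->
  continuous F -> (forall u : R, 0 <= u <= c -> 0 <= F u <= B) ->
  (forall u : R, 0 < u <= c -> F u <= L * u) ->
  linear_solution 0 c L a b z -> positive_decreasing 0 z ->
  exists x : nat -> R,
    [/\ curvature_solution 0 a b F x, x 0 = c, forall k, 0 < x k,
        forall k, Delta x k <= 0 & x @ \oo --> (0 : R)].
Proof.
move=> c_gt0 a_gt0 b_ge0 le_S1 le_S2 F_cont F_bounds F_le z_sol z_pos.
have B_ge0 : 0 <= B.
  have /F_bounds/andP[] : 0 <= c <= c by rewrite ltW/=.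
  exact: le_trans.
have drop := height_drop c_gt0 a_gt0 b_ge0 F_bounds.
have drop_sum := drop_bound_summable c_gt0 B_ge0 a_gt0 b_ge0 le_S1 le_S2.
have x0_gt0 := height_gt0_of_linear c_gt0 a_gt0 b_ge0 F_bounds F_le z_sol z_pos.
have [t lim0] := exists_decaying_shot c_gt0 a_gt0 b_ge0 F_cont F_bounds drop_sum x0_gt0.
have lim_eq0 : limn (height c a b F t) = 0 by exact: cvg_lim lim0.
have x_gt0 := height_gt0_of_lim0 c_gt0 a_gt0 b_ge0 F_bounds drop_sum lim_eq0.
exists (height c a b F t); split=> //.
  exact: (height_solves c_gt0 a_gt0 b_ge0 F_bounds x_gt0).
by move=> k; rewrite DeltaE -oppr_ge0 opprB; case/andP: (drop t k).
Qed.

Theorem theorem2 (R : realType) (m : nat) (c : R) (a b : nat -> R) (F : R -> R)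
  (c_gt0 : 0 < c)
  (a_gt0 : forall k, (m <= k)%N -> 0 < a k)
  (a_sum : (\sum_(m <= j <oo) ((a j)^-1)%:E < +oo)%E)
  (b_ge0 : forall k, (m <= k)%N -> 0 <= b k)
  (b_sum : (\sum_(m <= j <oo)
              ((b j)%:E * \sum_(j <= i <oo) ((a i)^-1)%:E) < +oo)%E)
  (F_cont : continuous F)
  (F_sign : forall u, u != 0 -> 0 < F u * u)
  (F_lim0 : exists l : R, F u / u @[u --> 0^'+] --> l)
  (linear_sol : exists z : nat -> R,
     linear_solution m c (sup [set F u / u | u in [set u | 0 < u <= c]]) a b z
     /\ positive_decreasing m z) :
  exists x : nat -> R,
    [/\ curvature_solution m a b F x,
        x m = c,
        forall k, (m <= k)%N -> 0 < x k,
        forall k, (m <= k)%N -> Delta x k <= 0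
      & x @ \oo --> (0 : R)].
Proof.
have [S1 le_S1] : exists S : R, forall n, \sum_(m <= i < n) (a i)^-1 <= S.
  have [|S le_S] := nneseries_partial_sums_le _ a_sum.
    by move=> j mj; rewrite lee_fin invr_ge0 ltW// a_gt0.
  by exists S => n; rewrite -lee_fin -sumEFin.
have [S2 le_S2] := tail_sums_le a_gt0 b_ge0 b_sum.
have [B F_bounds] := sign_bounded c_gt0 F_cont F_sign.
have F_le := sign_le_sup_ratio c_gt0 F_cont F_sign F_lim0.
case: linear_sol => z [z_sol z_pos].
have shift_sum (f : nat -> R) j n :
    \sum_(j + m <= i < n + m) f i = \sum_(j <= i < n) f (i + m)%N.
  by rewrite big_addn addnK.
(* Reindexing by k + m reduces to initial time 0. *)
have [||||||x [x_sol x0 x_gt0 dx x_lim]] := @bvp_solution_from_zero R c B _ S1 S2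
  (fun k => a (k + m)%N) (fun k => b (k + m)%N) (fun k => z (k + m)%N) F
  c_gt0 _ _ _ _ F_cont F_bounds F_le.
- by move=> k; rewrite a_gt0 ?leq_addl.
- by move=> k; rewrite b_ge0 ?leq_addl.
- by move=> n; rewrite -(shift_sum (fun i => (a i)^-1)) add0n.
- move=> n; apply: le_trans (le_S2 (n + m)%N).
  have := shift_sum (fun j => b j * \sum_(j <= i < n + m) (a i)^-1) 0 n.
  rewrite add0n => ->; apply: ler_sum => j _.
  by rewrite (shift_sum (fun i => (a i)^-1)).
- by move=> k _; exact: z_sol (leq_addl _ _).
- by move=> k _; exact: z_pos (leq_addl _ _).
exists (fun k => x (k - m)%N); split.
- move=> k mk; have := x_sol (k - m)%N (leq0n _).
  by rewrite !DeltaE addSn subnK// !subSn// leqW.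
- by rewrite subnn.
- by move=> k _; exact: x_gt0.
- by move=> k mk; rewrite DeltaE subSn//; exact: dx.
- rewrite -(cvg_shiftn m)/=; under eq_fun do rewrite addnK.
  exact: x_lim.
Qed.
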